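(* Let $\{W^{x,n}_{i,j+1/2}\},\{W^{y,n}_{i+1/2,j}\},\{Z^{n}_{i+1/2,j+1/2}\}$ be the solution of the RMAC scheme for the time-dependent Stokes equations (defined in the context) with source term $\mathbf g=(g^x,g^y)$, where $\mathbf g$ enters the scheme through the averages $$f^{x,n}_{i,j+1/2}=\frac1{h_i}\int_{x_{i-1/2}}^{x_{i+1/2}}g^x(x,y_{j+1/2},t^n)\,dx,\qquad f^{y,n}_{i+1/2,j}=\frac1{k_j}\int_{y_{j-1/2}}^{y_{j+1/2}}g^y(x_{i+1/2},y,t^n)\,dy .$$ Then the discrete velocity satisfies the following invariance property: if a gradient field $\nabla\phi$ is added to the source, $$\mathbf g\to\mathbf g+\nabla\phi\ \Rightarrow\ \bigl(\{W^{x,n}_{i,j+1/2}\},\{W^{y,n}_{i+1/2,j}\},\{Z^{n}_{i+1/2,j+1/2}\}\bigr)\to\bigl(\{W^{x,n}_{i,j+1/2}\},\{W^{y,n}_{i+1/2,j}\},\{(Z+P_h\phi)^n_{i+1/2,j+1/2}\}\bigr),$$ i.e. the solution of the scheme with $\mathbf g$ replaced by $\mathbf g+\nabla\phi$ (same boundary and initial data) has the same discrete velocity, and its discrete pressure is $Z+P_h\phi$.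
   Context: Grid. $\Omega=(0,L_x)\times(0,L_y)$, $\Delta t=T/N$, $t^n=n\Delta t$. Partitions $0=x_0<\dots<x_{N_x}=L_x$, $0=y_0<\dots<y_{N_y}=L_y$; $x_{i-1/2}=(x_i+x_{i-1})/2$, $h_{i-1/2}=x_i-x_{i-1}$, $y_{j-1/2}=(y_j+y_{j-1})/2$, $k_{j-1/2}=y_j-y_{j-1}$; $h_i=(h_{i+1/2}+h_{i-1/2})/2$ for $1\le i\le N_x-1$, $h_0=h_{1/2}/2$, $h_{N_x}=h_{N_x-1/2}/2$; similarly $k_j$, $k_0=k_{1/2}/2$, $k_{N_y}=k_{N_y-1/2}/2$. The partition is regular: $\min_{i,j}\{h_{i+1/2},k_{j+1/2}\}\ge C_0\max_{i,j}\{h_{i+1/2},k_{j+1/2}\}$ for a fixed $C_0>0$. For a function $\phi(x,y,t)$, $\phi^n_{l,m}=\phi(x_l,y_m,t^n)$. Difference operators. $[d_x\phi]_{i+1/2,m}=(\phi_{i+1,m}-\phi_{i,m})/h_{i+1/2}$, $[d_y\phi]_{l,j+1/2}=(\phi_{l,j+1}-\phi_{l,j})/k_{j+1/2}$, $[D_x\phi]_{i,m}=(\phi_{i+1/2,m}-\phi_{i-1/2,m})/h_{i}$, $[D_y\phi]_{l,j}=(\phi_{l,j+1/2}-\phi_{l,j-1/2})/k_{j}$, $[d_t\phi]^n=(\phi^n-\phi^{n-1})/\Delta t$. Coordinates outside the domain are replaced by the neighboring boundary ones: $[D_y\phi]_{l,0}=(\phi_{l,1/2}-\phi_{l,0})/k_0$,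 $[D_y\phi]_{l,N_y}=(\phi_{l,N_y}-\phi_{l,N_y-1/2})/k_{N_y}$, and similarly for $D_x$. RMAC scheme with source $\mathbf g$ and viscosity $\mu>0$. With $f^{x,n}_{i,j+1/2}$, $f^{y,n}_{i+1/2,j}$ the averages of $\mathbf g$ given in the claim, for $n\ge1$ find $W^{x,n},W^{y,n},Z^n$ with $$d_tW^{x,n}_{i,j+1/2}-\mu\,D_x(d_xW^{x,n})_{i,j+1/2}-\mu\,d_y(D_yW^{x,n})_{i,j+1/2}+D_xZ^n_{i,j+1/2}=f^{x,n}_{i,j+1/2}\quad(1\le i\le N_x-1,\ 0\le j\le N_y-1),$$ $$d_tW^{y,n}_{i+1/2,j}-\mu\,d_x(D_xW^{y,n})_{i+1/2,j}-\mu\,D_y(d_yW^{y,n})_{i+1/2,j}+D_yZ^n_{i+1/2,j}=f^{y,n}_{i+1/2,j}\quad(0\le i\le N_x-1,\ 1\le j\le N_y-1),$$ $$d_xW^{x,n}_{i+1/2,j+1/2}+d_yW^{y,n}_{i+1/2,j+1/2}=0\quad(0\le i\le N_x-1,\ 0\le j\le N_y-1),$$ with boundary values $W^{x,n}_{0,j+1/2}=W^{x,n}_{N_x,j+1/2}=W^{x,n}_{i,0}=W^{x,n}_{i,N_y}=0$, $W^{y,n}_{0,j}=W^{y,n}_{N_x,j}=W^{y,n}_{i+1/2,0}=W^{y,n}_{i+1/2,N_y}=0$, initial values $W^{x,0}=W^{y,0}=0$, and $Z^n\in W_h$, the space of cell-centered (piecewise constant) grid functions with discrete mean zero: $(Z^n,1)_{l^2,M}=0$,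 where $(f,g)_{l^2,M}=\sum_{i=0}^{N_x-1}\sum_{j=0}^{N_y-1}h_{i+1/2}k_{j+1/2}f_{i+1/2,j+1/2}g_{i+1/2,j+1/2}$. Operator $P_h$. $(P_hq)_{i+1/2,j+1/2}=q_{i+1/2,j+1/2}-(q,1)_{l^2,M}/|\Omega|$. The function $\phi$ is a scalar function of $(x,y,t)$. In the analogous invariance property of the continuous problem, the added gradient fields are $\nabla\phi$ with $\phi\in H^1(\Omega)$. *)

(* Defs.v *)
(* All integrals are Lebesgue integrals. *)
From HB Require Import structures.
From mathcomp Require Import all_boot all_order all_algebra.
From mathcomp Require Import all_classical all_reals all_analysis.
Set Implicit Arguments.
Unset Strict Implicit.
Unset Printing Implicit Defensive.
Import Order.TTheory GRing.Theory Num.Theory.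
Import numFieldNormedType.Exports.
Local Open Scope classical_set_scope.
Local Open Scope ring_scope.

(* Only the values [node i] with [i <= cells] are meaningful. *)
Record mesh1d (R : realType) (L : R) := Mesh1d {
  cells : nat;
  node : nat -> R;
  cells_gt0 : (0 < cells)%N;
  node_first : node 0%N = 0;
  node_last : node cells = L;
  node_lt : forall i, (i < cells)%N -> node i < node i.+1 }.

(* h_{i+1/2} *)
Definition step (R : realType) (L : R) (X : mesh1d L) (i : nat) : R :=
  node X i.+1 - node X i.

Definition min_step (R : realType) (L : R) (X : mesh1d L) : R :=
  \big[Num.min/step X 0]_(i < cells X) step X i.

Definition max_step (R : realType) (L : R) (X : mesh1d L) : R :=
  \big[Num.max/step X 0]_(i < cells X) step X i.

Definition regular_mesh (R : realType) (Lx Ly : R) (X : mesh1d Lx)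
    (Y : mesh1d Ly) (C0 : R) : Prop :=
  C0 * Num.max (max_step X) (max_step Y) <= Num.min (min_step X) (min_step Y).

(* From here on spatial indices are doubled: the natural number [l] stands for
   the index l/2, so that [i.*2] is the node index i and [i.*2.+1] is the
   index i + 1/2.  A grid function has type [nat -> nat -> R], and only its
   values at the locations where it lives are meaningful. *)

(* x_{l/2} *)
Definition point (R : realType) (L : R) (X : mesh1d L) (l : nat) : R :=
  if odd l then (node X l./2 + node X l./2.+1) / 2 else node X l./2.

(* h_{l/2} *)
Definition width (R : realType) (L : R) (X : mesh1d L) (l : nat) : R :=
  if odd l then step X l./2
  else if l == 0%N then step X 0 / 2
  else if l == (cells X).*2 then step X (cells X).-1 / 2
  else (step X l./2 + step X l./2.-1) / 2.

(* The operator d, to be used at half-integer indices (odd [l]). *)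
Definition diff_d (R : realType) (L : R) (X : mesh1d L) (u : nat -> R)
    (l : nat) : R :=
  (u l.+1 - u l.-1) / width X l.

(* The operator D, to be used at integer indices (even [l]).  The [minn], and
   the convention [0.-1 = 0], replace the coordinates that fall outside of the
   domain by the neighboring boundary ones. *)
Definition diff_D (R : realType) (L : R) (X : mesh1d L) (u : nat -> R)
    (l : nat) : R :=
  (u (minn l.+1 (cells X).*2) - u l.-1) / width X l.

Definition dx (R : realType) (Lx : R) (X : mesh1d Lx)
    (f : nat -> nat -> R) (l m : nat) : R := diff_d X (fun a => f a m) l.

Definition Dx (R : realType) (Lx : R) (X : mesh1d Lx)
    (f : nat -> nat -> R) (l m : nat) : R := diff_D X (fun a => f a m) l.

Definition dy (R : realType) (Ly : R) (Y : mesh1d Ly)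
    (f : nat -> nat -> R) (l m : nat) : R := diff_d Y (fun b => f l b) m.

Definition Dy (R : realType) (Ly : R) (Y : mesh1d Ly)
    (f : nat -> nat -> R) (l m : nat) : R := diff_D Y (fun b => f l b) m.

(* t^n *)
Definition time (R : realType) (T : R) (N n : nat) : R := n%:R * (T / N%:R).

Definition dt (R : realType) (T : R) (N : nat) (f : nat -> nat -> nat -> R)
    (n l m : nat) : R := (f n l m - f n.-1 l m) / (T / N%:R).

(* (f, g)_{l^2, M} *)
Definition l2M (R : realType) (Lx Ly : R) (X : mesh1d Lx) (Y : mesh1d Ly)
    (f g : nat -> nat -> R) : R :=
  \sum_(i < cells X) \sum_(j < cells Y)
    step X i * step Y j * f i.*2.+1 j.*2.+1 * g i.*2.+1 j.*2.+1.

Definition Ph (R : realType) (Lx Ly : R) (X : mesh1d Lx) (Y : mesh1d Ly)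
    (q : nat -> nat -> R) (l m : nat) : R :=
  q l m - l2M X Y q (fun _ _ => 1) / (Lx * Ly).

Definition sample (R : realType) (Lx Ly T : R) (X : mesh1d Lx)
    (Y : mesh1d Ly) (N : nat) (phi : R -> R -> R -> R) (n l m : nat) : R :=
  phi (point X l) (point Y m) (time T N n).

(* The interval [x_{i-1/2}, x_{i+1/2}], for 0 < i < cells X. *)
Definition dual_cell (R : realType) (L : R) (X : mesh1d L) (i : nat)
    : set R :=
  `[point X i.*2.-1, point X i.*2.+1].

(* f^{x,n}_{i,j+1/2} *)
Definition avg_x (R : realType) (Lx Ly T : R) (X : mesh1d Lx)
    (Y : mesh1d Ly) (N : nat) (gx : R -> R -> R -> R) (n i j : nat) : R :=
  (width X i.*2)^-1 *
  Rintegral (@lebesgue_measure R) (dual_cell X i)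
    (fun x => gx x (point Y j.*2.+1) (time T N n)).

(* f^{y,n}_{i+1/2,j} *)
Definition avg_y (R : realType) (Lx Ly T : R) (X : mesh1d Lx)
    (Y : mesh1d Ly) (N : nat) (gy : R -> R -> R -> R) (n i j : nat) : R :=
  (width Y j.*2)^-1 *
  Rintegral (@lebesgue_measure R) (dual_cell Y j)
    (fun y => gy (point X i.*2.+1) y (time T N n)).

Record rmac_solution (R : realType) (Lx Ly T mu : R) (X : mesh1d Lx)
    (Y : mesh1d Ly) (N : nat) (gx gy : R -> R -> R -> R)
    (Wx Wy Z : nat -> nat -> nat -> R) : Prop := RmacSolution {
  rmac_momentum_x : forall n i j,
    (0 < n <= N)%N -> (0 < i < cells X)%N -> (j < cells Y)%N ->
    dt T N Wx n i.*2 j.*2.+1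
    - mu * Dx X (dx X (Wx n)) i.*2 j.*2.+1
    - mu * dy Y (Dy Y (Wx n)) i.*2 j.*2.+1
    + Dx X (Z n) i.*2 j.*2.+1
    = avg_x T X Y N gx n i j;
  rmac_momentum_y : forall n i j,
    (0 < n <= N)%N -> (i < cells X)%N -> (0 < j < cells Y)%N ->
    dt T N Wy n i.*2.+1 j.*2
    - mu * dx X (Dx X (Wy n)) i.*2.+1 j.*2
    - mu * Dy Y (dy Y (Wy n)) i.*2.+1 j.*2
    + Dy Y (Z n) i.*2.+1 j.*2
    = avg_y T X Y N gy n i j;
  rmac_div : forall n i j,
    (0 < n <= N)%N -> (i < cells X)%N -> (j < cells Y)%N ->
    dx X (Wx n) i.*2.+1 j.*2.+1 + dy Y (Wy n) i.*2.+1 j.*2.+1 = 0;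
  rmac_boundary_x_sides : forall n j, (0 < n <= N)%N -> (j < cells Y)%N ->
    Wx n 0%N j.*2.+1 = 0 /\ Wx n (cells X).*2 j.*2.+1 = 0;
  rmac_boundary_x_ends : forall n i, (0 < n <= N)%N -> (i <= cells X)%N ->
    Wx n i.*2 0%N = 0 /\ Wx n i.*2 (cells Y).*2 = 0;
  rmac_boundary_y_sides : forall n j, (0 < n <= N)%N -> (j <= cells Y)%N ->
    Wy n 0%N j.*2 = 0 /\ Wy n (cells X).*2 j.*2 = 0;
  rmac_boundary_y_ends : forall n i, (0 < n <= N)%N -> (i < cells X)%N ->
    Wy n i.*2.+1 0%N = 0 /\ Wy n i.*2.+1 (cells Y).*2 = 0;
  rmac_initial_x : forall i j, (i <= cells X)%N -> (j < cells Y)%N ->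
    Wx 0%N i.*2 j.*2.+1 = 0;
  rmac_initial_y : forall i j, (i < cells X)%N -> (j <= cells Y)%N ->
    Wy 0%N i.*2.+1 j.*2 = 0;
  rmac_mean : forall n, (0 < n <= N)%N -> l2M X Y (Z n) (fun _ _ => 1) = 0 }.

(* The partial derivatives take an irrelevant value at the points where they
   do not exist. *)
Definition grad_x (R : realType) (phi : R -> R -> R -> R) (x y t : R) : R :=
  (fun s : R => phi s y t)^`()%classic x.

Definition grad_y (R : realType) (phi : R -> R -> R -> R) (x y t : R) : R :=
  (fun s : R => phi x s t)^`()%classic y.

Definition abs_continuous (R : realType) (a b : R) (F : R -> R) : Prop :=
  forall e : R, 0 < e -> exists2 d : R, 0 < d &
    forall (m : nat) (u v : 'I_m -> R),
      (forall i, a <= u i /\ u i <= v i /\ v i <= b) ->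
      trivIset setT (fun i => `]u i, v i[%classic) ->
      \sum_(i < m) (v i - u i) < d ->
      \sum_(i < m) `|F (v i) - F (u i)| < e.

(* [F] belongs to W^{1,1}(a, b), is its own absolutely continuous
   representative, and its derivative is the classical one, almost everywhere. *)
Definition has_gradient_on (R : realType) (a b : R) (F : R -> R) : Prop :=
  [/\ abs_continuous a b F,
      {ae @lebesgue_measure R, forall x : R, a < x < b -> derivable F x 1}
    & (@lebesgue_measure R).-integrable `[a, b] (EFin \o F^`()%classic)].

(* The point values of phi and the averages of its gradient that enter the
   scheme are taken along mesh lines.  This regularity along these lines gives
   them a meaning; it holds if phi is C^1 in space, and if phi is a
   representative of a function of H^1(Omega) that is absolutely continuous
   along the mesh lines with square integrable derivative. *)
Definition potential_ok (R : realType) (Lx Ly T : R) (X : mesh1d Lx)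
    (Y : mesh1d Ly) (N : nat) (phi : R -> R -> R -> R) : Prop :=
  (forall n i j, (0 < n <= N)%N -> (0 < i < cells X)%N -> (j < cells Y)%N ->
     has_gradient_on (point X i.*2.-1) (point X i.*2.+1)
       (fun x => phi x (point Y j.*2.+1) (time T N n))) /\
  (forall n i j, (0 < n <= N)%N -> (i < cells X)%N -> (0 < j < cells Y)%N ->
     has_gradient_on (point Y j.*2.-1) (point Y j.*2.+1)
       (fun y => phi (point X i.*2.+1) y (time T N n))).

(* The averages of g that enter the scheme exist. *)
Definition source_ok (R : realType) (Lx Ly T : R) (X : mesh1d Lx)
    (Y : mesh1d Ly) (N : nat) (gx gy : R -> R -> R -> R) : Prop :=
  (forall n i j, (0 < n <= N)%N -> (0 < i < cells X)%N -> (j < cells Y)%N ->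
     (@lebesgue_measure R).-integrable (dual_cell X i)
       (fun x => (gx x (point Y j.*2.+1) (time T N n))%:E)) /\
  (forall n i j, (0 < n <= N)%N -> (i < cells X)%N -> (0 < j < cells Y)%N ->
     (@lebesgue_measure R).-integrable (dual_cell Y j)
       (fun y => (gy (point X i.*2.+1) y (time T N n))%:E)).

(* Main.v *)
(* Along a mesh line, the average of the gradient of phi over a dual cell is
   the difference quotient of phi, so that replacing the source g by
   g + grad phi is exactly compensated in the momentum equations by adding phi,
   up to a constant, to the pressure.  Uniqueness follows, one time step at a
   time, from the discrete energy estimate: summation by parts makes both
   viscous terms dissipative, and turns the pressure term into a multiple of
   the discrete divergence.

   The fundamental theorem of calculus for an absolutely continuous F with
   derivative f compares F with the integral G of f.  The exceptional set where
   F - G does not have derivative 0 is covered by an open set U of small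
   measure.  In a fine enough tagged partition, the increments of F - G are
   small compared to the length around non-exceptional tags, while the
   intervals around exceptional tags lie in U, where absolute continuity
   controls F and the smallness of the integral of |f| controls G. *)
Require Import Defs.
From mathcomp Require Import all_boot all_order all_algebra.
From mathcomp Require Import all_classical all_reals all_analysis.
From mathcomp Require Import measurable_realfun.
From mathcomp Require Import ring lra zify.
Import Order.TTheory GRing.Theory Num.Theory.
Import numFieldNormedType.Exports.
Local Open Scope classical_set_scope.
Local Open Scope ring_scope.

Set Implicit Arguments.
Unset Strict Implicit.
Unset Printing Implicit Defensive.

(** * The fundamental theorem of calculus for absolutely continuous functions *)

(** Cousin's lemma on fine tagged partitions, as an induction principle with tag [x]. The supremum
    of the points reached from [a] is itself reached, and it cannot lie below [b]. *)
Lemma cousin_ind (R : realType) (a b : R) (P : R -> R -> Prop) : a <= b ->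
  (forall u v w, a <= u -> u <= v -> v <= w -> w <= b ->
    P u v -> P v w -> P u w) ->
  (forall x, a <= x <= b -> exists2 d : R, 0 < d &
    forall u v, a <= u -> u <= x -> x <= v -> v <= b ->
      x - d < u -> v < x + d -> P u v) ->
  P a b.
Proof.
move=> ab addP locP.
pose S : set R := [set x | a <= x <= b /\ P a x].
have Sa : S a.
  split; first by rewrite lexx.
  have [|d d0 Pd] := locP a; first by rewrite lexx.
  by apply: Pd => //; lra.
have supS : has_sup S.
  by split; [exists a | exists b => x [/andP[]]].
set c := sup S.
have ac : a <= c by exact: (sup_upper_bound supS).
have cb : c <= b by apply: (ge_sup (proj1 supS)) => x [/andP[]].
have [|d d0 Pd] := locP c; first by rewrite ac.
have [x [/andP[ax xb] Px] cx] := sup_adherent d0 supS.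
have xc : x <= c by apply: (sup_upper_bound supS); split=> //; rewrite ax.
have Pc v : c <= v -> v <= b -> v < c + d -> P a v.
  move=> cv vb vd; apply: (addP a x v) => //; first exact: le_trans cv.
  exact: Pd.
have [bc|cb'|bc] := ltgtP b c; [lra| |by apply: Pc => //; lra].
(* If [c < b], the local property at [c] reaches this point beyond [c], against the choice of [c] as
   a supremum. *)
pose v := Num.min b (c + d / 2).
have cv : c < v by rewrite lt_min; apply/andP; split; lra.
have vb : v <= b by rewrite ge_min lexx.
have vd : v <= c + d / 2 by rewrite ge_min lexx orbT.
suff : v <= c by lra.
apply: (sup_upper_bound supS); split; first by apply/andP; split; lra.
by apply: Pc => //; lra.
Qed.

(** Ordered sequences, unlike families indexed by ['I_m], are easy to concatenate when adjacent
    intervals are joined. Consecutive intervals may share an endpoint, since only their interiors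
    have to be disjoint. *)
Lemma abs_continuous_seq (R : realType) (a b : R) (F : R -> R) (e : R) :
  abs_continuous a b F -> 0 < e -> exists2 d : R, 0 < d &
    forall s : seq (R * R),
      all (fun p => [&& a <= p.1, p.1 <= p.2 & p.2 <= b]) s ->
      pairwise (fun p q => p.2 <= q.1) s ->
      \sum_(p <- s) (p.2 - p.1) < d ->
      \sum_(p <- s) `|F p.2 - F p.1| < e.
Proof.
move=> acF e0; have [d d0 Fd] := acF _ e0; exists d => // s sab dis.
rewrite (big_nth (0, 0)) big_mkord => sd.
rewrite (big_nth (0, 0)) big_mkord.
apply: (Fd (size s) (fun i => (nth (0, 0) s i).1)
  (fun i => (nth (0, 0) s i).2)) => //.
  by move=> i; have /and3P[] := all_nthP (0, 0) sab _ (ltn_ord i).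
have lt_dis (i j : 'I_(size s)) x : (i < j)%N ->
    `](nth (0, 0) s i).1, (nth (0, 0) s i).2[%classic x ->
    `](nth (0, 0) s j).1, (nth (0, 0) s j).2[%classic x -> False.
  move=> ij; rewrite /= !in_itv /= => /andP[_ xi] /andP[xj _].
  have := pairwiseP (0, 0) dis _ _ (ltn_ord i) (ltn_ord j) ij.
  by move=> /(lt_le_trans xi) /(lt_trans xj); rewrite ltxx.
move=> i j _ _ [x [xi xj]]; apply/val_inj => /=.
have [ij|ij|//] := ltngtP i j; first by case: (lt_dis _ _ _ ij xi xj).
by case: (lt_dis _ _ _ ij xj xi).
Qed.

Lemma derive_eq0_bound (R : realType) (H : R -> R) (x e : R) :
  derivable H x 1 -> H^`()%classic x = 0 -> 0 < e ->
  exists2 d : R, 0 < d &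
    forall y, `|y - x| < d -> `|H y - H x| <= e * `|y - x|.
Proof.
move=> dH H0 e0.
have {dH} : _ --> 'D_1 H x := dH.
rewrite -derive1E H0.
move=> /cvgrPdist_le /(_ _ e0) [d /= d0 Hd]; exists d => // y yx.
(* The limit defining the derivative ignores the increment 0, so [y = x] is treated apart. *)
have [->|yNx] := eqVneq y x; first by rewrite !subrr normr0 mulr0.
have := Hd (y - x); rewrite /= sub0r normrN subr_eq0 => /(_ yx yNx).
rewrite sub0r normrN /GRing.scale /= mulr1 subrK normrM normfV.
by rewrite mulrC ler_pdivrMr// normr_gt0 subr_eq0.
Qed.

Section absolute_continuity.
Context {R : realType}.
Notation mu := (@lebesgue_measure R).
Implicit Types (g : R -> R) (u v : R).

(** The base point -oo gives a primitive on the whole line, in the form that [FTC1Ny] differentiates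
    almost everywhere. *)
Definition integral_upto g x := \int[mu]_(t in `]-oo, x]) g t.

Lemma integral_uptoB g u v : mu.-integrable setT (EFin \o g) -> u <= v ->
  integral_upto g v - integral_upto g u = \int[mu]_(t in `]u, v]) g t.
Proof.
move=> ig uv; rewrite /integral_upto Rintegral_itvB ?bnd_simp//.
exact: integrableS ig.
Qed.

Lemma integral_uptoB_le g u v : mu.-integrable setT (EFin \o g) ->
  (forall t, 0 <= g t) -> u <= v ->
  integral_upto g v - integral_upto g u <= \int[mu]_t g t.
Proof.
move=> ig g0 uv; rewrite integral_uptoB// Rintegral_mkcond.
apply: le_Rintegral => //.
  rewrite -restrict_EFin -integrable_mkcond//; exact: integrableS ig.
by move=> t _; rewrite patchE; case: ifP.
Qed.

Lemma abs_continuous_FTC (a b : R) (F f : R -> R) : a < b ->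
  abs_continuous a b F ->
  mu.-integrable setT (EFin \o f) ->
  {ae mu, forall x : R, a < x < b ->
    derivable F x 1 /\ F^`()%classic x = f x} ->
  \int[mu]_(t in `]a, b]) f t = F b - F a.
Proof.
move=> ab acF intf aeF.
pose G := integral_upto f.
have aeG : {ae mu, forall x : R, derivable G x 1 /\ G^`()%classic x = f x}.
  apply: FTC1Ny; last exact: open_integrable_locally openT intf.
  by move=> y; exact: integrableS intf.
pose H : R -> R := F - G.
have aeH : {ae mu, forall x : R, a <= x <= b ->
    derivable H x 1 /\ H^`()%classic x = 0}.
  (* Discarding the two endpoints, a null set, lets the tags range over the closed interval, as
     Cousin's lemma requires. *)
  have ae1 c : {ae mu, forall x : R, x != c}.
    exists [set c]; split => //; first exact: lebesgue_measure_set1.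
    by move=> x /= /negP; rewrite negbK => /eqP.
  have aeFilter := ae_filter_ringOfSetsType mu.
  apply: filterS3 (filterI aeF aeG) (ae1 a) (ae1 b) => x [Fx [dG G'x]] xa xb.
  move=> /andP[ax bx].
  have [|dF F'x] := Fx; first by rewrite !lt_neqAle ax bx xb eq_sym xa.
  split; first exact: (derivableB dF dG).
  by rewrite derive1E (deriveB dF dG) -!derive1E F'x G'x subrr.
have [A [mA A0 notA]] := aeH.
rewrite -integral_uptoB ?(ltW ab)// -/G.
apply/eqP; rewrite -subr_eq0 -normr_le0; apply/ler_addgt0Pl => e e0.
rewrite addr0 distrC.
(* One third each for the tags where [H] has derivative 0, the increments of [F] inside [U], and
   those of [G] inside [U]. *)
have e30 : 0 < e / 3 by lra.
have [d1 d10 Fd1] := abs_continuous_seq acF e30.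
have [d2 [d20 fd2]] := integral_normr_continuous intf e30.
(* Outer regularity bounds the measure of [U] minus [A], which is that of [U] because [A] is null.
   The minimum serves [F] through [d1] and [G] through [d2]. *)
have [U [oU AU UA]] : exists U : set R,
    [/\ open U, A `<=` U & (mu U < (Num.min d1 d2)%:E)%E].
  have [||U [oU AU UA]] := @lebesgue_regularity_outer R A (Num.min d1 d2) mA.
  - by rewrite [X in (X < _)%E]A0 ltry.
  - by rewrite lt_min d10.
  exists U; split => //; apply: le_lt_trans UA.
  have mU := open_measurable oU.
  have UA0 : mu (U `&` A) = 0%E.
    by apply: subset_measure0 A0 => //; exact: measurableI.
  by rewrite (measureDI mu mU mA) [X in (_ + X)%E]UA0 adde0.
have mU : measurable U := open_measurable oU.
have Ufin : (mu U < +oo)%E := lt_trans UA (ltry _).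
(* Increments of M measure the part of an interval that lies in U, and
   increments of K dominate those of G inside U. *)
pose M := integral_upto ((cst 1 : R -> R) \_ U).
pose K := integral_upto ((Num.norm \o f) \_ U).
have iM : mu.-integrable setT (EFin \o ((cst 1 : R -> R) \_ U)).
  rewrite -restrict_EFin -integrable_mkcond//.
  apply/integrableP; split; first exact/measurable_EFinP/measurable_cst.
  rewrite (_ : (fun _ => _) = cst 1%E).
    by rewrite integral_cst// mul1e.
  by apply/funext => t /=; rewrite normr1.
have iK : mu.-integrable setT (EFin \o ((Num.norm \o f) \_ U)).
  rewrite -restrict_EFin -integrable_mkcond//.
  by apply: integrableS (integrable_norm intf).
have restrictU (g : R -> R) u v : (forall t, u < t -> t <= v -> U t) ->
    \int[mu]_(t in `]u, v]) (g \_ U) t = \int[mu]_(t in `]u, v]) g t.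
  move=> uvU; apply: eq_Rintegral => t; rewrite inE /= in_itv /=.
  by move=> /andP[ut tv]; rewrite patchE mem_set//; exact: uvU.
have M_id u v : u <= v -> (forall t, u < t -> t <= v -> U t) ->
    M v - M u = v - u.
  move=> uv uvU; rewrite integral_uptoB// restrictU// Rintegral_cst// mul1r.
  rewrite [X in fine X]lebesgue_measure_itv /= lte_fin.
  by move: uv; rewrite le_eqVlt => /predU1P[->|->]//; rewrite ltxx subrr.
have K_ge u v : u <= v -> (forall t, u < t -> t <= v -> U t) ->
    `|G v - G u| <= K v - K u.
  move=> uv uvU; rewrite !integral_uptoB// restrictU//.
  by apply: le_normr_Rintegral => //; exact: integrableS intf.
have M_lt : M b - M a < d1.
  apply: le_lt_trans (integral_uptoB_le iM _ (ltW ab)) _.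
    by move=> t; rewrite patchE; case: ifP.
  rewrite -Rintegral_mkcond Rintegral_cst// mul1r -lte_fin fineK.
    by apply: lt_le_trans UA _; rewrite lee_fin ge_min lexx.
  by rewrite ge0_fin_numE.
have K_lt : K b - K a < e / 3.
  apply: le_lt_trans (integral_uptoB_le iK _ (ltW ab)) _.
    by move=> t; rewrite patchE; case: ifP => //= _; exact: normr_ge0.
  rewrite -Rintegral_mkcond; apply: fd2 => //.
  by apply: lt_le_trans UA _; rewrite lee_fin ge_min lexx orbT.
have M_mono u v : u <= v -> M u <= M v.
  move=> uv; rewrite -subr_ge0 integral_uptoB//; apply: Rintegral_ge0 => t _.
  by rewrite patchE; case: ifP.
have K_mono u v : u <= v -> K u <= K v.
  move=> uv; rewrite -subr_ge0 integral_uptoB//; apply: Rintegral_ge0 => t _.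
  by rewrite patchE; case: ifP => //= _; exact: normr_ge0.
pose r := e / 3 / (b - a).
have r0 : 0 < r by rewrite divr_gt0// subr_gt0.
(* The increments of F are kept as a sum over a family s of intervals, instead
   of being bounded by e / 3: this makes P additive, and absolute continuity is
   applied only once, to the whole family. *)
pose P u v := exists s : seq (R * R),
  [/\ all (fun p => [&& u <= p.1, p.1 <= p.2 & p.2 <= v]) s,
      pairwise (fun p q => p.2 <= q.1) s,
      \sum_(p <- s) (p.2 - p.1) <= M v - M u
    & `|H v - H u| <=
      r * (v - u) + \sum_(p <- s) `|F p.2 - F p.1| + (K v - K u)].
have HE x : H x = F x - G x by [].
have rba : r * (b - a) = e / 3 by rewrite /r divfK// gt_eqF// subr_gt0.
clearbody H M K G r.
(* The total length of [s] is at most [M b - M a < d1], so absolute continuity applies to [s]. *)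
suff [s [sab dis slen Hab]] : P a b.
  have := Fd1 s sab dis (le_lt_trans slen M_lt).
  move=> sF; rewrite (_ : _ - _ = H b - H a); last by rewrite !HE; ring.
  by apply: le_trans Hab _; lra.
apply: (cousin_ind (ltW ab)).
- move=> u v w au uv vw wb [s [suv ds ls Hs]] [s' [svw ds' ls' Hs']].
  exists (s ++ s'); split.
  + rewrite all_cat; apply/andP; split.
      apply: sub_all suv => p /and3P[-> -> /= pv]; exact: le_trans vw.
    by apply: sub_all svw => p /and3P[/(le_trans uv)-> -> ->].
  + rewrite pairwise_cat ds ds' !andbT; apply/allrelP => p q ps qs.
    have /and3P[_ _ pv] := allP suv _ ps.
    by have /and3P[/(le_trans pv)] := allP svw _ qs.
  + by rewrite big_cat/=; lra.
  + rewrite big_cat/= (_ : H w - H u = (H v - H u) + (H w - H v)); last by ring.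
    by apply: le_trans (ler_normD _ _) _; lra.
(* An exceptional tag puts its whole interval into the family; any other tag leaves the family empty
   and uses the slope [r]. *)
- move=> x axb; have [xA|xNA] := pselect (A x).
    have [d /= d0 dU] :=
      (nbhs_ballP _ _).1 (open_nbhs_nbhs (conj oU (AU _ xA))).
    exists d => // u v au ux xv vb ud vd.
    have uvU t : u < t -> t <= v -> U t.
      move=> ut tv; apply: dU; rewrite /ball /= ltr_distl.
      by apply/andP; split; lra.
    have uv := le_trans ux xv.
    exists [:: (u, v)]; split => //=.
    + by rewrite !lexx uv.
    + by rewrite big_seq1 /= M_id.
    + rewrite big_seq1 /= (_ : H v - H u = (F v - F u) - (G v - G u)).
        apply: le_trans (ler_normB _ _) _.
        have := K_ge _ _ uv uvU.
        have : 0 <= r * (v - u) by rewrite mulr_ge0 ?subr_ge0// ltW.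
        lra.
      by rewrite !HE; ring.
  have [dH H'x] : derivable H x 1 /\ H^`()%classic x = 0.
    by apply: contrapT => nH; apply: xNA; apply: notA => /= /(_ axb).
  have [d d0 Hd] := derive_eq0_bound dH H'x r0.
  exists d => // u v au ux xv vb ud vd.
  have uv := le_trans ux xv.
  exists [::]; split => //=; first by rewrite big_nil subr_ge0 M_mono.
  rewrite big_nil addr0.
  (* Passing through the tag [x], the two sides contribute at most [r * (v - x)] and
     [r * (x - u)]. *)
  rewrite (_ : H v - H u = (H v - H x) - (H u - H x)); last by ring.
  apply: le_trans (ler_normB _ _) _.
  have := K_mono _ _ uv.
  have := Hd u; rewrite distrC ger0_norm ?subr_ge0// ltrBlDr -ltrBlDl.
  move=> /(_ ud).
  have := Hd v; rewrite ger0_norm ?subr_ge0// ltrBlDl => /(_ vd).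
  lra.
Qed.

End absolute_continuity.

Lemma gradient_integral (R : realType) (a b : R) (F : R -> R) : a < b ->
  has_gradient_on a b F ->
  \int[@lebesgue_measure R]_(t in `[a, b]) F^`()%classic t = F b - F a.
Proof.
move=> ab [acF dF iF].
(* Extending the derivative by zero outside [[a, b]] makes it integrable on the whole line. *)
have iF' := iF; move: iF'; rewrite integrable_mkcond// restrict_EFin => iF'.
rewrite -(abs_continuous_FTC ab acF iF'); last first.
  have aeFilter := ae_filter_ringOfSetsType (@lebesgue_measure R).
  apply: filterS dF => x dF axb; split; first exact: dF.
  rewrite patchE mem_set//= in_itv /=.
  by case/andP: axb => /ltW -> /ltW.
rewrite Rintegral_itv_obnd_cbnd; last by apply: integrableS iF'.
by apply: eq_Rintegral => t tab; rewrite patchE tab.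
Qed.

(** * Difference operators and summation by parts on a one-dimensional mesh *)

Section mesh.
Variables (R : realType) (L : R) (X : mesh1d L).
Implicit Types (u p : nat -> R) (i : nat).

Lemma step_gt0 i : (i < cells X)%N -> 0 < step X i.
Proof. by move=> iX; rewrite subr_gt0 node_lt. Qed.

Lemma width_odd i : width X i.*2.+1 = step X i.
Proof. by rewrite /width /= odd_double /= uphalf_double. Qed.

Lemma width_even_gt0 i : (i <= cells X)%N -> 0 < width X i.*2.
Proof.
move=> iX; have X0 := cells_gt0 X.
rewrite /width odd_double double_eq0 (inj_eq double_inj) doubleK.
have [_|i0] := posnP i; first by rewrite divr_gt0// step_gt0.
case: eqVneq => [_|iNX]; first by rewrite divr_gt0// step_gt0// prednK.
by rewrite divr_gt0// addr_gt0// step_gt0//; lia.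
Qed.

Lemma sum_step : \sum_(0 <= i < cells X) step X i = L.
Proof. by rewrite telescope_sumr// node_last node_first subr0. Qed.

Lemma point_lt i : (0 < i < cells X)%N ->
  Defs.point X i.*2.-1 < Defs.point X i.*2.+1.
Proof.
case: i => // i /= iX; rewrite /Defs.point doubleS /= odd_double /=.
rewrite uphalf_double.
have := node_lt (ltnW iX); have := node_lt iX; lra.
Qed.

Lemma diff_D_interior u i : (0 < i < cells X)%N ->
  diff_D X u i.*2 = (u i.*2.+1 - u i.*2.-1) / width X i.*2.
Proof. by move=> iX; rewrite /diff_D (minn_idPl _)//; lia. Qed.

(** Abel summation, with [v] on nodes and [q] on cells. The left sum starts at 1, so [i.-1] is never
    truncated. *)
Lemma sum_by_parts (v q : nat -> R) n : (0 < n)%N ->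
  \sum_(1 <= i < n) v i * (q i - q i.-1) =
  q n.-1 * v n - q 0%N * v 0%N - \sum_(0 <= i < n) q i * (v i.+1 - v i).
Proof.
case: n => // n _; elim: n => [|n IHn].
  by rewrite big_geq// big_nat1 /=; ring.
by rewrite big_nat_recr//= IHn [in RHS]big_nat_recr//=; ring.
Qed.

(** [D] is minus the adjoint of [d] for the weights [width] and [step]: the zero values of [u] at
    the end nodes remove the boundary terms. *)
Lemma sum_diff_D u p : u 0%N = 0 -> u (cells X).*2 = 0 ->
  \sum_(1 <= i < cells X) width X i.*2 * (u i.*2 * diff_D X p i.*2) =
  - \sum_(0 <= i < cells X) step X i * (p i.*2.+1 * diff_d X u i.*2.+1).
Proof.
move=> u0 uX.
have -> : \sum_(1 <= i < cells X) width X i.*2 * (u i.*2 * diff_D X p i.*2) =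
    \sum_(1 <= i < cells X) u i.*2 * (p i.*2.+1 - p i.-1.*2.+1).
  apply: eq_big_nat => i iX; rewrite diff_D_interior//.
  have -> : i.-1.*2.+1 = i.*2.-1 by lia.
  field; rewrite gt_eqF// width_even_gt0//; lia.
rewrite (@sum_by_parts (fun i => u i.*2) (fun i => p i.*2.+1)) ?cells_gt0//.
rewrite u0 uX !mulr0 subrr sub0r; congr (- _).
apply: eq_big_nat => i /= iX; rewrite /diff_d width_odd.
by field; rewrite gt_eqF// step_gt0.
Qed.

(** Adjointness with [p := diff_d X u] leaves minus a weighted sum of squares. *)
Lemma sum_diff_Dd_le0 u : u 0%N = 0 -> u (cells X).*2 = 0 ->
  \sum_(1 <= i < cells X) width X i.*2 * (u i.*2 * diff_D X (diff_d X u) i.*2)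
  <= 0.
Proof.
move=> u0 uX; rewrite sum_diff_D// oppr_le0 big_nat sumr_ge0// => i /= iX.
by rewrite mulr_ge0 ?(ltW (step_gt0 _))// -expr2 sqr_ge0.
Qed.

(** Here [u] has cell values and two boundary values, like [Wx] in the y direction. The one-sided
    quotients at the end nodes also contribute minus squares, weighted by the half widths. *)
Lemma sum_diff_dD_le0 u : u 0%N = 0 -> u (cells X).*2 = 0 ->
  \sum_(0 <= i < cells X)
    step X i * (u i.*2.+1 * diff_d X (diff_D X u) i.*2.+1) <= 0.
Proof.
move=> u0 uX; have X0 := cells_gt0 X.
pose r i := diff_D X u i.*2.
have -> : \sum_(0 <= i < cells X)
      step X i * (u i.*2.+1 * diff_d X (diff_D X u) i.*2.+1) =
    \sum_(0 <= i < cells X) u i.*2.+1 * (r i.+1 - r i).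
  apply: eq_big_nat => i /= iX; rewrite /diff_d width_odd /r doubleS.
  by field; rewrite gt_eqF// step_gt0.
have sbp := @sum_by_parts r (fun i => u i.*2.+1) _ X0.
(* Since [u] vanishes at both ends, its first and last cell values are the end quotients times the
   half widths, with opposite signs. The boundary terms of [sbp] thus become minus squares. *)
have w0 : width X 0 * r 0%N = u 1%N.
  rewrite /r /diff_D u0 subr0 mulrC divfK; last first.
    by rewrite gt_eqF// (@width_even_gt0 0).
  by rewrite (minn_idPl _)//; lia.
have wX : width X (cells X).*2 * r (cells X) = - u (cells X).-1.*2.+1.
  rewrite /r /diff_D mulrC divfK ?gt_eqF ?width_even_gt0//.
  rewrite (minn_idPr _) ?uX ?sub0r; last by lia.
  by congr (- u _); lia.
have : 0 <= \sum_(1 <= i < cells X) r i * (u i.*2.+1 - u i.-1.*2.+1).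
  rewrite big_nat sumr_ge0// => i iX.
  have -> : u i.*2.+1 - u i.-1.*2.+1 = r i * width X i.*2.
    rewrite /r diff_D_interior// divfK ?gt_eqF ?width_even_gt0//; last by lia.
    by congr (_ - u _); lia.
  by rewrite mulrA -expr2 mulr_ge0 ?sqr_ge0// ltW// width_even_gt0//; lia.
have : 0 <= width X 0 * r 0%N * r 0%N.
  by rewrite -mulrA -expr2 mulr_ge0 ?sqr_ge0// ltW// (@width_even_gt0 0).
have : 0 <= width X (cells X).*2 * r (cells X) * r (cells X).
  by rewrite -mulrA -expr2 mulr_ge0 ?sqr_ge0// ltW// width_even_gt0.
by move: sbp; rewrite w0 wX; lra.
Qed.

Lemma diff_dD_eq0 u i : u 0%N = 0 -> u (cells X).*2 = 0 ->
  (forall i', (i' < cells X)%N -> u i'.*2.+1 = 0) -> (i < cells X)%N ->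
  diff_d X (diff_D X u) i.*2.+1 = 0.
Proof.
move=> u0 uX uin iX.
have D0 k : (k <= cells X)%N -> diff_D X u k.*2 = 0.
  (* At the last node [minn] selects the boundary value instead of a cell value; at node 0 the
     convention [0.-1 = 0] does the same on the left. *)
  move=> kX; rewrite /diff_D (_ : u (minn _ _) = 0); last first.
    have [kX'|kX'] := ltnP k (cells X).
      by rewrite (minn_idPl _) ?uin//; lia.
    by rewrite (minn_idPr _) ?uX//; lia.
  case: k kX => [|k] kX; first by rewrite u0 subrr mul0r.
  by rewrite doubleS /= uin// subrr mul0r.
by rewrite /diff_d -doubleS !D0 ?(ltnW iX)// subrr mul0r.
Qed.

Lemma diff_Dd_eq0 u i : (forall i', (i' <= cells X)%N -> u i'.*2 = 0) ->
  (0 < i < cells X)%N -> diff_D X (diff_d X u) i.*2 = 0.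
Proof.
move=> u0 iX.
have d0 k : (k < cells X)%N -> diff_d X u k.*2.+1 = 0.
  by move=> kX; rewrite /diff_d -doubleS !u0 ?(ltnW kX)// subrr mul0r.
rewrite diff_D_interior// (_ : i.*2.-1 = i.-1.*2.+1); last by lia.
by rewrite !d0 ?subrr ?mul0r//; lia.
Qed.

End mesh.

(** * The discrete inner product and the mean-zero projection *)

Section l2M.
Variables (R : realType) (Lx Ly : R) (X : mesh1d Lx) (Y : mesh1d Ly).
Implicit Types f g h : nat -> nat -> R.

Lemma eq_l2M f g h :
  (forall i j, (i < cells X)%N -> (j < cells Y)%N ->
     f i.*2.+1 j.*2.+1 = g i.*2.+1 j.*2.+1) ->
  l2M X Y f h = l2M X Y g h.
Proof.
by move=> fg; apply: eq_bigr => i _; apply: eq_bigr => j _; rewrite fg.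
Qed.

Lemma l2MD f g h :
  l2M X Y (fun l m => f l m + g l m) h = l2M X Y f h + l2M X Y g h.
Proof.
rewrite /l2M -big_split; apply: eq_bigr => i _.
by rewrite -big_split; apply: eq_bigr => j _ /=; ring.
Qed.

Lemma l2MN f h : l2M X Y (fun l m => - f l m) h = - l2M X Y f h.
Proof.
rewrite /l2M -sumrN; apply: eq_bigr => i _.
by rewrite -sumrN; apply: eq_bigr => j _ /=; ring.
Qed.

(** The steps add up to the side lengths, so the total weight is the area by which [Ph] divides. *)
Lemma l2M_cst c : l2M X Y (fun _ _ => c) (fun _ _ => 1) = c * (Lx * Ly).
Proof.
rewrite /l2M -[in RHS](sum_step X) -[in RHS](sum_step Y) !big_mkord.
rewrite mulr_suml mulr_sumr; apply: eq_bigr => i _.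
by rewrite !mulr_sumr; apply: eq_bigr => j _; ring.
Qed.

Lemma l2M_Ph q : Lx * Ly != 0 -> l2M X Y (Ph X Y q) (fun _ _ => 1) = 0.
Proof.
by move=> L0; rewrite (l2MD q) l2M_cst mulNr divfK// subrr.
Qed.

End l2M.

(** * Energy estimate and pressure equation for one velocity component *)

Lemma psumr_nat_eq0 (R : realType) (m n : nat) (F : nat -> R) :
  (forall i, (m <= i < n)%N -> 0 <= F i) -> \sum_(m <= i < n) F i <= 0 ->
  forall i, (m <= i < n)%N -> F i = 0.
Proof.
move=> F0 sF i imn; apply/eqP; rewrite eq_le F0// andbT.
apply: le_trans sF; rewrite (big_rem i) /=; last by rewrite mem_index_iota.
rewrite lerDl big_seq sumr_ge0// => k /mem_rem.
by rewrite mem_index_iota => /F0.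
Qed.

Section component.
Variables (R : realType) (Lx Ly : R) (X : mesh1d Lx) (Y : mesh1d Ly).
Variables (tau mu : R) (E e : nat -> nat -> R).
Hypotheses (tau_gt0 : 0 < tau) (mu_gt0 : 0 < mu).
Hypothesis E_sides : forall j, (j < cells Y)%N ->
  E 0%N j.*2.+1 = 0 /\ E (cells X).*2 j.*2.+1 = 0.
Hypothesis E_ends : forall i, (i <= cells X)%N ->
  E i.*2 0%N = 0 /\ E i.*2 (cells Y).*2 = 0.
Hypothesis momentum : forall i j, (0 < i < cells X)%N -> (j < cells Y)%N ->
  E i.*2 j.*2.+1 / tau - mu * Dx X (dx X E) i.*2 j.*2.+1
  - mu * dy Y (Dy Y E) i.*2 j.*2.+1 + Dx X e i.*2 j.*2.+1 = 0.

(** The result of testing [E / tau] against [E]. The field [E] stands for the difference of two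
    solutions that agree at the previous time, so its time quotient is [E / tau]. *)
Let kinetic := \sum_(1 <= i < cells X) \sum_(0 <= j < cells Y)
  width X i.*2 * step Y j * (E i.*2 j.*2.+1 ^+ 2 / tau).

Let kinetic_term_ge0 i j : (0 < i < cells X)%N -> (0 <= j < cells Y)%N ->
  0 <= width X i.*2 * step Y j * (E i.*2 j.*2.+1 ^+ 2 / tau).
Proof.
move=> /andP[_ /ltnW iX] jY; apply: mulr_ge0; last first.
  by rewrite divr_ge0 ?sqr_ge0 ?(ltW tau_gt0).
by rewrite mulr_ge0 ?(ltW (step_gt0 _)) ?(ltW (width_even_gt0 _)).
Qed.

Lemma component_kinetic_ge0 : 0 <= kinetic.
Proof.
rewrite /kinetic big_nat sumr_ge0// => i iX; rewrite big_nat sumr_ge0// => j.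
exact: kinetic_term_ge0.
Qed.

Lemma component_eq0 : kinetic <= 0 ->
  forall i j, (i <= cells X)%N -> (j < cells Y)%N -> E i.*2 j.*2.+1 = 0.
Proof.
move=> k0 i j iX jY; have [Ej0 EjX] := E_sides jY.
have [->//|i0] := posnP i; have [iX'|Xi] := ltnP i (cells X); last first.
  by have /eqP -> : i == cells X by rewrite eqn_leq iX.
have i0X : (0 < i < cells X)%N by rewrite i0.
have row_ge0 k : (0 < k < cells X)%N -> 0 <= \sum_(0 <= l < cells Y)
    width X k.*2 * step Y l * (E k.*2 l.*2.+1 ^+ 2 / tau).
  by move=> kX; rewrite big_nat sumr_ge0// => l; exact: kinetic_term_ge0.
have row0 := psumr_nat_eq0 row_ge0 k0 i0X.
have := psumr_nat_eq0 (fun l => @kinetic_term_ge0 i l i0X) _ (i := j) jY.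
rewrite row0 => /(_ (lexx 0)) /eqP.
rewrite !mulf_eq0 invr_eq0 (gt_eqF tau_gt0) (gt_eqF (step_gt0 jY)).
by rewrite (gt_eqF (width_even_gt0 iX)) /= !orbF orbb => /eqP.
Qed.

(** The momentum equation is tested against [E]: both viscous sums have a favorable sign, and
    adjointness moves the difference from the pressure onto [E]. *)
Lemma component_energy :
  kinetic <=
  \sum_(0 <= i < cells X) \sum_(0 <= j < cells Y)
    step X i * step Y j * (e i.*2.+1 j.*2.+1 * dx X E i.*2.+1 j.*2.+1).
Proof.
(* Each term is summed first along the direction of its differences, where the one-dimensional
   results apply. *)
pose visc_x j := \sum_(1 <= i < cells X)
  width X i.*2 * (E i.*2 j.*2.+1 * Dx X (dx X E) i.*2 j.*2.+1).
pose visc_y i := \sum_(0 <= j < cells Y)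
  step Y j * (E i.*2 j.*2.+1 * dy Y (Dy Y E) i.*2 j.*2.+1).
pose work j := \sum_(1 <= i < cells X)
  width X i.*2 * (E i.*2 j.*2.+1 * Dx X e i.*2 j.*2.+1).
have -> : kinetic = mu * (\sum_(0 <= j < cells Y) step Y j * visc_x j) +
    mu * (\sum_(1 <= i < cells X) width X i.*2 * visc_y i) -
    \sum_(0 <= j < cells Y) step Y j * work j.
  under [X in _ = mu * X + _ - _]eq_bigr do rewrite mulr_sumr.
  under [X in _ = _ + mu * X - _]eq_bigr do rewrite mulr_sumr.
  under [X in _ = _ - X]eq_bigr do rewrite mulr_sumr.
  rewrite [X in _ = mu * X + _ - _]exchange_big_nat.
  rewrite [X in _ = _ - X]exchange_big_nat /= !mulr_sumr -big_split -sumrB.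
  apply: eq_big_nat => i iX; rewrite !mulr_sumr -big_split -sumrB.
  apply: eq_big_nat => j jY; have := momentum iX jY.
  move=> /(congr1 ( *%R (width X i.*2 * step Y j * E i.*2 j.*2.+1))) /=.
  by rewrite mulr0 => eq0; apply: subr0_eq; rewrite -[RHS]eq0; ring.
have visc_x_le0 : \sum_(0 <= j < cells Y) step Y j * visc_x j <= 0.
  rewrite big_nat -oppr_ge0 -sumrN sumr_ge0// => j jY.
  rewrite -mulrN mulr_ge0 ?(ltW (step_gt0 _))// oppr_ge0.
  by have [] := E_sides jY; exact: (@sum_diff_Dd_le0 _ _ X (E ^~ j.*2.+1)).
have visc_y_le0 : \sum_(1 <= i < cells X) width X i.*2 * visc_y i <= 0.
  rewrite big_nat -oppr_ge0 -sumrN sumr_ge0// => i /andP[_ /ltnW iX].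
  rewrite -mulrN mulr_ge0 ?(ltW (width_even_gt0 _))// oppr_ge0.
  by have [] := E_ends iX; exact: (@sum_diff_dD_le0 _ _ Y (E i.*2)).
have -> : \sum_(0 <= j < cells Y) step Y j * work j =
    - \sum_(0 <= i < cells X) \sum_(0 <= j < cells Y)
      step X i * step Y j * (e i.*2.+1 j.*2.+1 * dx X E i.*2.+1 j.*2.+1).
  rewrite [X in _ = - X]exchange_big_nat /= -sumrN.
  apply: eq_big_nat => j jY; have [Ej0 EjX] := E_sides jY.
  rewrite [work j](@sum_diff_D _ _ X (E ^~ j.*2.+1) (e ^~ j.*2.+1))//.
  rewrite mulrN mulr_sumr.
  by congr (- _); apply: eq_bigr => i _; rewrite /dx; ring.
rewrite opprK -[leRHS]add0r lerD2r -[leRHS](addr0 0).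
by apply: lerD; rewrite pmulr_rle0.
Qed.

(** Without velocity, the momentum equation reduces to a vanishing [Dx X e] at interior nodes, so
    neighboring cells carry equal pressures. *)
Lemma component_pressure :
  (forall i j, (i <= cells X)%N -> (j < cells Y)%N -> E i.*2 j.*2.+1 = 0) ->
  forall i j, (i < cells X)%N -> (j < cells Y)%N ->
    e i.*2.+1 j.*2.+1 = e 1%N j.*2.+1.
Proof.
move=> E0 i j + jY; elim: i => // i IHi iX; rewrite -IHi ?(ltnW iX)//.
have := @momentum i.+1 j iX jY.
rewrite E0 ?(ltnW iX)// mul0r.
rewrite [Dx X (dx X E) _ _](@diff_Dd_eq0 _ _ X (E ^~ j.*2.+1))//; last first.
  by move=> k kX; rewrite E0.
have [Ei0 EiY] := E_ends (ltnW iX).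
rewrite [dy Y (Dy Y E) _ _](@diff_dD_eq0 _ _ Y (E i.+1.*2))//; last first.
  by move=> k kY; rewrite E0 ?(ltnW iX).
rewrite /Dx diff_D_interior// !mulr0 !subr0 add0r => /eqP.
rewrite mulf_eq0 invr_eq0 (gt_eqF (width_even_gt0 (ltnW iX))) orbF subr_eq0.
by rewrite doubleS => /eqP.
Qed.

End component.

(** * Uniqueness of the discrete solution *)

(** In the sum of the two energy estimates the pressure multiplies the discrete divergence and
    disappears, so the velocity vanishes. The pressure is then a constant, which its zero mean
    forces to be 0. *)
Lemma homogeneous_rmac_step (R : realType) (Lx Ly tau mu : R) (X : mesh1d Lx)
    (Y : mesh1d Ly) (Ex Ey e : nat -> nat -> R) :
  0 < Lx -> 0 < Ly -> 0 < tau -> 0 < mu ->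
  (forall j, (j < cells Y)%N ->
     Ex 0%N j.*2.+1 = 0 /\ Ex (cells X).*2 j.*2.+1 = 0) ->
  (forall i, (i <= cells X)%N -> Ex i.*2 0%N = 0 /\ Ex i.*2 (cells Y).*2 = 0) ->
  (forall j, (j <= cells Y)%N -> Ey 0%N j.*2 = 0 /\ Ey (cells X).*2 j.*2 = 0) ->
  (forall i, (i < cells X)%N ->
     Ey i.*2.+1 0%N = 0 /\ Ey i.*2.+1 (cells Y).*2 = 0) ->
  (forall i j, (0 < i < cells X)%N -> (j < cells Y)%N ->
    Ex i.*2 j.*2.+1 / tau - mu * Dx X (dx X Ex) i.*2 j.*2.+1
    - mu * dy Y (Dy Y Ex) i.*2 j.*2.+1 + Dx X e i.*2 j.*2.+1 = 0) ->
  (forall i j, (i < cells X)%N -> (0 < j < cells Y)%N ->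
    Ey i.*2.+1 j.*2 / tau - mu * dx X (Dx X Ey) i.*2.+1 j.*2
    - mu * Dy Y (dy Y Ey) i.*2.+1 j.*2 + Dy Y e i.*2.+1 j.*2 = 0) ->
  (forall i j, (i < cells X)%N -> (j < cells Y)%N ->
    dx X Ex i.*2.+1 j.*2.+1 + dy Y Ey i.*2.+1 j.*2.+1 = 0) ->
  l2M X Y e (fun _ _ => 1) = 0 ->
  [/\ forall i j, (i <= cells X)%N -> (j < cells Y)%N -> Ex i.*2 j.*2.+1 = 0,
      forall i j, (i < cells X)%N -> (j <= cells Y)%N -> Ey i.*2.+1 j.*2 = 0
    & forall i j, (i < cells X)%N -> (j < cells Y)%N ->
        e i.*2.+1 j.*2.+1 = 0].
Proof.
move=> Lx0 Ly0 tau0 mu0 Exs Exe Eys Eye mx my div mean.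
(* Exchanging the roles of x and y turns the equations of Ey into those of Ex. *)
pose Ey' a b := Ey b a; pose e' a b := e b a.
have my' i j : (0 < i < cells Y)%N -> (j < cells X)%N ->
    Ey' i.*2 j.*2.+1 / tau - mu * Dx Y (dx Y Ey') i.*2 j.*2.+1
    - mu * dy X (Dy X Ey') i.*2 j.*2.+1 + Dx Y e' i.*2 j.*2.+1 = 0.
  by move=> iY jX; rewrite -(my _ _ jX iY) /Dx /Dy /dx /dy /Ey' /e'; ring.
have enx := component_energy mu0 Exs Exe mx.
have eny := component_energy (E := Ey') (e := e') mu0 Eye Eys my'.
set kx := (X in X <= _) in enx; set ky := (X in X <= _) in eny.
have kx_ge0 : 0 <= kx := component_kinetic_ge0 X Y Ex tau0.
have ky_ge0 : 0 <= ky := component_kinetic_ge0 Y X Ey' tau0.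
have kxy : kx + ky <= 0.
  apply: le_trans (lerD enx eny) _.
  rewrite [X in _ + X]exchange_big_nat /= -big_split /= big_nat big1// => i iX.
  rewrite -big_split /= big_nat big1// => j jY.
  rewrite /e' [dx Y Ey' _ _](_ : _ = - dx X Ex i.*2.+1 j.*2.+1); first by ring.
  by apply/eqP; rewrite -addr_eq0 addrC; apply/eqP; exact: div.
have Ex0 : forall i j, (i <= cells X)%N -> (j < cells Y)%N ->
    Ex i.*2 j.*2.+1 = 0.
  by apply: (component_eq0 (E := Ex) tau0 Exs); rewrite -/kx; lra.
have Ey0 : forall i j, (i <= cells Y)%N -> (j < cells X)%N ->
    Ey' i.*2 j.*2.+1 = 0.
  apply: (component_eq0 (X := Y) (Y := X) (E := Ey') tau0 Eye); rewrite -/ky.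
  lra.
split=> // [i j iX jY|i j iX jY]; first exact: Ey0.
(* The x-momentum equation leads along row [l] to the first column, and the y-momentum equation
   along that column to the first cell. *)
have econst k l : (k < cells X)%N -> (l < cells Y)%N ->
    e k.*2.+1 l.*2.+1 = e 1%N 1%N.
  move=> kX lY; rewrite (component_pressure Exe mx Ex0)//.
  exact: (component_pressure (E := Ey') (e := e') Eys my' Ey0 lY (cells_gt0 X)).
rewrite econst//; move: mean; rewrite (eq_l2M (g := fun _ _ => e 1%N 1%N))//.
move/eqP; rewrite l2M_cst mulf_eq0 mulf_eq0 (gt_eqF Lx0) (gt_eqF Ly0) !orbF.
by move/eqP.
Qed.

Section rmac.
Variables (R : realType) (Lx Ly T mu : R) (X : mesh1d Lx) (Y : mesh1d Ly).
Variables (N : nat).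
Hypotheses (Lx_gt0 : 0 < Lx) (Ly_gt0 : 0 < Ly) (T_gt0 : 0 < T).
Hypotheses (N_gt0 : (0 < N)%N) (mu_gt0 : 0 < mu).
Implicit Types gx gy phi : R -> R -> R -> R.

(** By linearity the difference of the solutions solves the homogeneous step; agreement at time
    [n.-1] reduces [dt] to division by the time step. *)
Lemma rmac_step_unique gx gy Wx Wy Z Vx Vy Q n :
  rmac_solution T mu X Y N gx gy Wx Wy Z ->
  rmac_solution T mu X Y N gx gy Vx Vy Q ->
  (0 < n <= N)%N ->
  (forall i j, (i <= cells X)%N -> (j < cells Y)%N ->
     Vx n.-1 i.*2 j.*2.+1 = Wx n.-1 i.*2 j.*2.+1) ->
  (forall i j, (i < cells X)%N -> (j <= cells Y)%N ->
     Vy n.-1 i.*2.+1 j.*2 = Wy n.-1 i.*2.+1 j.*2) ->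
  [/\ forall i j, (i <= cells X)%N -> (j < cells Y)%N ->
        Vx n i.*2 j.*2.+1 = Wx n i.*2 j.*2.+1,
      forall i j, (i < cells X)%N -> (j <= cells Y)%N ->
        Vy n i.*2.+1 j.*2 = Wy n i.*2.+1 j.*2
    & forall i j, (i < cells X)%N -> (j < cells Y)%N ->
        Q n i.*2.+1 j.*2.+1 = Z n i.*2.+1 j.*2.+1].
Proof.
move=> solW solV n0 prevx prevy.
have tau0 : 0 < T / N%:R by rewrite divr_gt0// ltr0n.
pose Ex l m := Vx n l m - Wx n l m; pose Ey l m := Vy n l m - Wy n l m.
pose e l m := Q n l m - Z n l m.
have [||||||||Ex0 Ey0 e0] := @homogeneous_rmac_step R Lx Ly (T / N%:R) mu X Y
    Ex Ey e Lx_gt0 Ly_gt0 tau0 mu_gt0.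
- move=> j jY; rewrite /Ex; have [-> ->] := rmac_boundary_x_sides solV n0 jY.
  by have [-> ->] := rmac_boundary_x_sides solW n0 jY; rewrite subrr.
- move=> i iX; rewrite /Ex; have [-> ->] := rmac_boundary_x_ends solV n0 iX.
  by have [-> ->] := rmac_boundary_x_ends solW n0 iX; rewrite subrr.
- move=> j jY; rewrite /Ey; have [-> ->] := rmac_boundary_y_sides solV n0 jY.
  by have [-> ->] := rmac_boundary_y_sides solW n0 jY; rewrite subrr.
- move=> i iX; rewrite /Ey; have [-> ->] := rmac_boundary_y_ends solV n0 iX.
  by have [-> ->] := rmac_boundary_y_ends solW n0 iX; rewrite subrr.
- move=> i j iX jY; have /andP[_ /ltnW iX'] := iX.
  have := rmac_momentum_x solV n0 iX jY.
  rewrite -(rmac_momentum_x solW n0 iX jY) => /eqP.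
  rewrite -subr_eq0 => /eqP eq0; rewrite -[RHS]eq0.
  rewrite /dt prevx// /Dx /dx /Dy /dy /Ex /e /diff_D /diff_d; ring.
- move=> i j iX jY; have /andP[_ /ltnW jY'] := jY.
  have := rmac_momentum_y solV n0 iX jY.
  rewrite -(rmac_momentum_y solW n0 iX jY) => /eqP.
  rewrite -subr_eq0 => /eqP eq0; rewrite -[RHS]eq0.
  rewrite /dt prevy// /Dx /dx /Dy /dy /Ey /e /diff_D /diff_d; ring.
- move=> i j iX jY; have eq0 := subrr (0 : R).
  rewrite -{1}(rmac_div solV n0 iX jY) -{1}(rmac_div solW n0 iX jY) in eq0.
  by rewrite -[RHS]eq0 /dx /dy /Ex /Ey /diff_d; ring.
- by rewrite /e l2MD l2MN (rmac_mean solV n0) (rmac_mean solW n0) subrr.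
- by split=> i j iX jY; apply/eqP; rewrite -subr_eq0; apply/eqP;
    [exact: Ex0|exact: Ey0|exact: e0].
Qed.

(** Time levels are coupled through [dt] of the velocity alone, so the induction carries only
    velocities; the pressure at time [n] follows from the velocities at [n.-1]. *)
Lemma rmac_unique gx gy Wx Wy Z Vx Vy Q :
  rmac_solution T mu X Y N gx gy Wx Wy Z ->
  rmac_solution T mu X Y N gx gy Vx Vy Q ->
  [/\ forall n i j, (n <= N)%N -> (i <= cells X)%N -> (j < cells Y)%N ->
        Vx n i.*2 j.*2.+1 = Wx n i.*2 j.*2.+1,
      forall n i j, (n <= N)%N -> (i < cells X)%N -> (j <= cells Y)%N ->
        Vy n i.*2.+1 j.*2 = Wy n i.*2.+1 j.*2
    & forall n i j, (0 < n <= N)%N -> (i < cells X)%N -> (j < cells Y)%N ->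
        Q n i.*2.+1 j.*2.+1 = Z n i.*2.+1 j.*2.+1].
Proof.
move=> solW solV.
have vel n : (n <= N)%N ->
    (forall i j, (i <= cells X)%N -> (j < cells Y)%N ->
       Vx n i.*2 j.*2.+1 = Wx n i.*2 j.*2.+1) /\
    (forall i j, (i < cells X)%N -> (j <= cells Y)%N ->
       Vy n i.*2.+1 j.*2 = Wy n i.*2.+1 j.*2).
  elim: n => [_|n IHn nN].
    split=> i j iX jY.
      by rewrite (rmac_initial_x solV)// (rmac_initial_x solW).
    by rewrite (rmac_initial_y solV)// (rmac_initial_y solW).
  have [px py] := IHn (ltnW nN).
  by have [] := rmac_step_unique (n := n.+1) solW solV nN px py.
split=> n i j nN; [exact: (vel n nN).1|exact: (vel n nN).2|].
have [|px py] := vel n.-1.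
  by case/andP: nN => _; exact/leq_trans/leq_pred.
by have [_ _] := rmac_step_unique solW solV nN px py; exact.
Qed.

(** * Sources augmented by a gradient *)

(** Integrability of both summands splits the average. The dual cell ends at cell centers, where
    [phi] is sampled, and its length is the divisor in [Dx]. *)
Lemma avg_x_grad gx gy phi n i j : source_ok T X Y N gx gy ->
  potential_ok T X Y N phi ->
  (0 < n <= N)%N -> (0 < i < cells X)%N -> (j < cells Y)%N ->
  avg_x T X Y N (fun x y t => gx x y t + grad_x phi x y t) n i j =
  avg_x T X Y N gx n i j + Dx X (sample T X Y N phi n) i.*2 j.*2.+1.
Proof.
move=> [gx_ok _] [phi_ok _] nN iX jY.
have phi_grad := phi_ok _ _ _ nN iX jY; have [_ _ iphi] := phi_grad.
rewrite /avg_x RintegralD//; [|exact: measurable_itv|exact: gx_ok].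
rewrite mulrDr; congr (_ + _).
rewrite (gradient_integral (point_lt iX) phi_grad).
by rewrite /Dx diff_D_interior// mulrC.
Qed.

Lemma avg_y_grad gx gy phi n i j : source_ok T X Y N gx gy ->
  potential_ok T X Y N phi ->
  (0 < n <= N)%N -> (i < cells X)%N -> (0 < j < cells Y)%N ->
  avg_y T X Y N (fun x y t => gy x y t + grad_y phi x y t) n i j =
  avg_y T X Y N gy n i j + Dy Y (sample T X Y N phi n) i.*2.+1 j.*2.
Proof.
move=> [_ gy_ok] [_ phi_ok] nN iX jY.
have phi_grad := phi_ok _ _ _ nN iX jY; have [_ _ iphi] := phi_grad.
rewrite /avg_y RintegralD//; [|exact: measurable_itv|exact: gy_ok].
rewrite mulrDr; congr (_ + _).
rewrite (gradient_integral (point_lt jY) phi_grad).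
by rewrite /Dy diff_D_interior// mulrC.
Qed.

(** Differences ignore the constant subtracted by [Ph], so the momentum equations see [phi] itself,
    while that constant restores the zero mean of the pressure. *)
Lemma rmac_add_gradient gx gy phi Wx Wy Z :
  source_ok T X Y N gx gy -> potential_ok T X Y N phi ->
  rmac_solution T mu X Y N gx gy Wx Wy Z ->
  rmac_solution T mu X Y N (fun x y t => gx x y t + grad_x phi x y t)
    (fun x y t => gy x y t + grad_y phi x y t) Wx Wy
    (fun n l m => Z n l m + Ph X Y (sample T X Y N phi n) l m).
Proof.
move=> g_ok phi_ok sol; split; try by case: sol.
- move=> n i j nN iX jY; rewrite (avg_x_grad g_ok)//.
  rewrite -(rmac_momentum_x sol nN iX jY).
  by rewrite /Dx /diff_D /Ph; ring.
- move=> n i j nN iX jY; rewrite (avg_y_grad g_ok)//.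
  rewrite -(rmac_momentum_y sol nN iX jY).
  by rewrite /Dy /diff_D /Ph; ring.
- move=> n nN; rewrite (l2MD X Y (Z n)) (rmac_mean sol nN) add0r l2M_Ph//.
  by rewrite mulf_neq0 ?gt_eqF.
Qed.

End rmac.

Theorem lemma1 (R : realType) (Lx Ly T mu C0 : R) (X : mesh1d Lx)
    (Y : mesh1d Ly) (N : nat) (gx gy phi : R -> R -> R -> R)
    (Wx Wy Z : nat -> nat -> nat -> R) :
  0 < Lx -> 0 < Ly -> 0 < T -> (0 < N)%N -> 0 < mu ->
  0 < C0 -> regular_mesh X Y C0 ->
  source_ok T X Y N gx gy ->
  potential_ok T X Y N phi ->
  rmac_solution T mu X Y N gx gy Wx Wy Z ->
  let gx' := fun x y t => gx x y t + grad_x phi x y t in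
  let gy' := fun x y t => gy x y t + grad_y phi x y t in
  let Z' := fun n l m => Z n l m + Ph X Y (sample T X Y N phi n) l m in
  rmac_solution T mu X Y N gx' gy' Wx Wy Z' /\
  forall Vx Vy Q : nat -> nat -> nat -> R,
    rmac_solution T mu X Y N gx' gy' Vx Vy Q ->
    [/\ forall n i j, (n <= N)%N -> (i <= cells X)%N -> (j < cells Y)%N ->
          Vx n i.*2 j.*2.+1 = Wx n i.*2 j.*2.+1,
        forall n i j, (n <= N)%N -> (i < cells X)%N -> (j <= cells Y)%N ->
          Vy n i.*2.+1 j.*2 = Wy n i.*2.+1 j.*2
      & forall n i j, (0 < n <= N)%N -> (i < cells X)%N -> (j < cells Y)%N ->
          Q n i.*2.+1 j.*2.+1 = Z' n i.*2.+1 j.*2.+1].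

Proof.
move=> Lx0 Ly0 T0 N0 mu0 _ _ g_ok phi_ok sol gx' gy' Z'.
have sol' := rmac_add_gradient Lx0 Ly0 g_ok phi_ok sol; split=> //.
by move=> Vx Vy Q; exact: rmac_unique.
Qed.
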